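(* Let $X$ and $Y$ be compact metric spaces, each homeomorphic to the Cantor set. Let $f : X \to X$ be a continuous surjective mapping that is chain mixing, and let $g : Y \to Y$ be an aperiodic homeomorphism. Suppose that $f$ has a fixed point. Then $(Y,g) \vartriangleright (X,f)$.
   Context: A topological dynamical system is a pair $(X,f)$ where $(X,d)$ is a compact metric space and $f$ is a continuous mapping from $X$ onto itself. $\mathbf{Z}_+$ denotes the set of positive integers. Chain mixing: for $\delta>0$, a sequence $x_0,x_1,\dots,x_l$ of elements of $X$ is a $\delta$ chain from $x_0$ to $x_l$ of length $l$ if $d(f(x_i),x_{i+1})<\delta$ for all $i=0,1,\dots,l-1$. $(X,f)$ (or $f$) is chain mixing if for every $\delta>0$ and every pair $x,y\in X$ there exists a positive integer $N$ such that for all $n\ge N$ there exists a $\delta$ chain from $x$ to $y$ of length $n$. Aperiodic: $g$ is periodic of period $n$ ($n \in \mathbf{Z}_+$) if $g^n = \mathrm{id}_Y$; $g$ is aperiodic if it is not periodic of period $n$ for any $n\in\mathbf{Z}_+$. The relation $\vartriangleright$: for topological dynamical systems $(Y,g)$ and $(X,f)$, $(Y,g)\vartriangleright(X,f)$ means that there exists a sequence of homeomorphisms $\psi_k : Y\to X$ ($k=1,2,\dots$) such that $\psi_k\circ g\circ\psi_k^{-1}\to f$ as $k\to\infty$ uniformly, i.e. in the metric $d(f,f') := \sup_{x\in X} d(f(x),f'(x))$. *)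

(* Defs.v *)
From mathcomp Require Import all_boot all_order all_algebra.
From mathcomp Require Import all_classical all_reals all_analysis.

Set Implicit Arguments.
Unset Strict Implicit.
Unset Printing Implicit Defensive.

Import Order.TTheory GRing.Theory Num.Theory.
Import numFieldNormedType.Exports.

Local Open Scope classical_set_scope.
Local Open Scope ring_scope.

Definition inverse_homeomorphisms (S T : topologicalType)
    (h : S -> T) (k : T -> S) : Prop :=
  [/\ continuous h, continuous k, cancel h k & cancel k h].

Definition is_homeomorphism (S T : topologicalType) (h : S -> T) : Prop :=
  exists k : T -> S, inverse_homeomorphisms h k.

Definition homeomorphic (S T : topologicalType) : Prop :=
  exists h : S -> T, is_homeomorphism h.

(* Only the values c 0, ..., c l matter. *)
Definition is_chain (R : realType) (X : metricType R) (f : X -> X)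
    (delta : R) (x y : X) (l : nat) (c : nat -> X) : Prop :=
  [/\ c 0%N = x, c l = y &
      forall i : nat, (i < l)%N -> mdist (f (c i)) (c i.+1) < delta].

Definition chain_mixing (R : realType) (X : metricType R) (f : X -> X) : Prop :=
  forall delta : R, 0 < delta -> forall x y : X,
  exists N : nat, (0 < N)%N /\
    forall n : nat, (N <= n)%N ->
      exists c : nat -> X, is_chain f delta x y n c.

Definition periodic_of_period (T : Type) (n : nat) (g : T -> T) : Prop :=
  iter n g = id.

Definition aperiodic (T : Type) (g : T -> T) : Prop :=
  forall n : nat, (0 < n)%N -> ~ periodic_of_period n g.

(* The supremum is taken in R; it is the true one when X is compact, since the
   distances are then bounded. *)
Definition sup_dist (R : realType) (X : metricType R) (f f' : X -> X) : R :=
  sup [set mdist (f x) (f' x) | x in [set: X]].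

(* (Y, g) |> (X, f), for topological dynamical systems; phi k is the inverse
   of psi k. *)
Definition conjugates_approximate (R : realType) (Y X : metricType R)
    (g : Y -> Y) (f : X -> X) : Prop :=
  exists (psi : nat -> Y -> X) (phi : nat -> X -> Y),
    (forall k : nat, inverse_homeomorphisms (psi k) (phi k)) /\
    sup_dist (psi k \o g \o phi k) f @[k --> \oo] --> (0 : R).

(* Main.v *)
Require Import Defs.
From mathcomp Require Import all_boot all_order all_algebra.
From mathcomp Require Import all_classical all_reals all_analysis.
From mathcomp Require Import lra.

(** Write [C] for the Cantor space.  To get [psi g psi^-1] uniformly close to
    [f], it is enough to have a locally constant map [phi] from [Y] to [X] such
    that [phi (g y)] is close to [f (phi y)] for all [y], and whose values meet
    every piece of a fine clopen partition of [X].  Indeed the fibres of [phi]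
    over the pieces are then nonempty clopen sets, hence Cantor sets, just like
    the pieces themselves; matching each fibre with its piece by a homeomorphism
    produces a homeomorphism [psi] that is uniformly close to [phi]
    ([approx_by_homeo]).

    The map [phi] is a tower over a clopen base.  Chain mixing gives a
    [delta]-chain [c 0, ..., c n] of [f] that starts and ends at the fixed point
    [p] and meets every piece ([chain_through]).  As [g] is aperiodic, some point
    of [Y] does not return to itself in fewer than [n] steps: otherwise the
    [n!]-th iterate of [g] would be the identity.  By continuity a whole clopen
    neighbourhood [A] of that point has no return to [A] before time [n]
    ([cylinder_no_short_return]).  Let [phi] be [c i] on the [i]-th image of [A]
    under [g], for [i < n], and [p] everywhere else.  Climbing the tower follows
    the chain; leaving it, entering it, and staying outside all take place at
    [p], where [f p = p] lets the chain wait for any length of time.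

    Everything is carried out on [C], where a clopen set is one that depends on
    finitely many bits, and is then transported to [X] and [Y]. *)

Set Implicit Arguments.
Unset Strict Implicit.
Unset Printing Implicit Defensive.

Import Order.TTheory GRing.Theory Num.Theory.
Import numFieldNormedType.Exports.

Local Open Scope classical_set_scope.

(** * Cylinders of the Cantor space *)

Definition agree (n : nat) (x y : cantor_space) : Prop :=
  forall i, (i < n)%N -> x i = y i.

Lemma agree_sym n x y : agree n x y -> agree n y x.
Proof. by move=> xy i /xy. Qed.

Lemma agree_trans n x y z : agree n x y -> agree n y z -> agree n x z.
Proof. by move=> xy yz i ni; rewrite xy// yz. Qed.

Lemma agreeW m n x y : (m <= n)%N -> agree n x y -> agree m x y.
Proof. by move=> mn xy i im; apply: xy; exact: leq_trans im mn. Qed.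

Lemma nbhs_bit (x : cantor_space) i : \forall y \near x, y i = x i.
Proof.
apply: (@proj_continuous nat (fun=> bool) i x [set b | b = x i]).
by rewrite nbhs_principalE.
Qed.

Lemma nbhs_agree (x : cantor_space) n : \forall y \near x, agree n x y.
Proof.
elim: n => [|n IH]; first by near=> y => i.
near=> y => i; rewrite ltnS leq_eqVlt => /predU1P[->|].
  by apply/esym; near: y; exact: nbhs_bit.
by move: i; near: y.
Unshelve. all: by end_near. Qed.

(** By compactness: the cylinders around [x] decrease to [x], so one of them
    misses the compact complement of a given open neighbourhood. *)
Lemma nbhs_cylinder (x : cantor_space) (U : set cantor_space) :
  nbhs x U -> exists n, agree n x `<=` U.
Proof.
rewrite nbhsE => -[V [oV Vx] VU].
have /compact_near_coveringP/(_ nat \oo (fun n y => ~ agree n x y)) :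
    compact (~` V).
  apply: (subclosed_compact _ cantor_space_compact) => //.
  exact: open_closedC.
case=> [y Vy|N _ NV].
  have /existsNP[i xyi] : ~ forall i, x i = y i.
    move=> xy; apply: Vy; suff <- : x = y by [].
    by apply: functional_extensionality_dep.
  exists ([set z | z i = y i], [set n | (i < n)%N]) => /=.
    by split; [exact: nbhs_bit | exists i.+1].
  by move=> [z n] /= [zy im] /(_ _ im); rewrite zy.
exists N => y xy; apply: VU; apply: contrapT => Vy.
exact: (NV N (leqnn N) y Vy).
Qed.

Lemma continuous_bits (T : topologicalType) (u : T -> cantor_space) :
  (forall t i, \forall s \near t, u s i = u t i) -> continuous u.
Proof.
move=> uc t U /nbhs_cylinder[n nU].
apply: filterS (_ : nbhs t (fun s => agree n (u t) (u s))).
  by move=> s /nU.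
elim: n {nU} => [|n IH]; first by near=> y => i.
near=> y => i; rewrite ltnS leq_eqVlt => /predU1P[->|].
  by apply/esym; near: y; exact: uc.
by move: i; near: y.
Unshelve. all: by end_near. Qed.

(** The Lebesgue number lemma on [C].  It gives at once that continuous maps to
    metric spaces are uniformly continuous, and that locally constant maps and
    clopen sets depend on finitely many bits only. *)
Lemma lebesgue_number (Q : cantor_space -> cantor_space -> Prop) :
  (forall x : cantor_space, exists2 U : set cantor_space,
     nbhs x U & forall y z, U y -> U z -> Q y z) ->
  exists n, forall y z, agree n y z -> Q y z.
Proof.
move=> Q_loc.
have /compact_near_coveringP/(_ nat \oo
  (fun n y => forall z, agree n y z -> Q y z)) := cantor_space_compact.
case=> [x _|N _ /(_ N (leqnn N)) NQ]; last by exists N => y z; exact: NQ.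
have [U /nbhs_cylinder[n nU] UQ] := Q_loc x.
exists (agree n x, [set m | (n <= m)%N]) => /=.
  by split; [exact: nbhs_agree | exists n].
move=> [y m] /= [xy nm] z yz; apply: UQ; apply: nU => //.
exact: agree_trans xy (agreeW nm yz).
Qed.

(** * Parametrizing clopen sets by the Cantor space *)

Definition bcons (b : bool) (x : cantor_space) : cantor_space :=
  fun i => if i is j.+1 then x j else b.

Definition btail (x : cantor_space) : cantor_space := fun i => x i.+1.

Lemma bcons_btail x : bcons (x 0) (btail x) = x.
Proof. by apply: functional_extensionality_dep => -[]. Qed.

Lemma bcons_inj b : injective (bcons b).
Proof. by move=> x y bxy; rewrite -[x]/(btail (bcons b x)) bxy. Qed.

Lemma agree_bcons n b x y : agree n x y -> agree n.+1 (bcons b x) (bcons b y).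
Proof. by move=> xy [|i]//= /xy. Qed.

Lemma agree_btail n x y : agree n.+1 x y -> agree n (btail x) (btail y).
Proof. by move=> xy i ni; exact: xy. Qed.

Lemma bcons_continuous b : continuous (bcons b).
Proof.
apply: continuous_bits => x [|i] /=; last exact: nbhs_bit.
by near=> y.
Unshelve. all: by end_near. Qed.

Lemma btail_continuous : continuous btail.
Proof. by apply: continuous_bits => x i; exact: nbhs_bit. Qed.

(** [C] is the disjoint union of the sequences starting with either bit, each a
    copy of [C]; so two maps on [C] glue into one. *)
Definition glue (T : Type) (e : bool -> cantor_space -> T) : cantor_space -> T :=
  fun x => e (x 0) (btail x).

Lemma glue_continuous (T : topologicalType) (e : bool -> cantor_space -> T) :
  (forall b, continuous (e b)) -> continuous (glue e).
Proof.
move=> ec x U; rewrite /glue => eU.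
have := @continuous_comp _ _ _ btail (e (x 0)) x (@btail_continuous x) (ec _ _).
move=> /(_ _ eU) eU'.
rewrite /= in eU'.
change (\forall y \near x, U (e (y 0) (btail y))); near=> y.
have -> : y 0 = x 0 by near: y; exact: nbhs_bit.
by near: y.
Unshelve. all: by end_near. Qed.

Lemma glue_inj (T : Type) (e : bool -> cantor_space -> T) :
  (forall b, injective (e b)) -> (forall x y, e true x <> e false y) ->
  injective (glue e).
Proof.
move=> einj edisj x y; rewrite /glue -{3}(bcons_btail x) -{3}(bcons_btail y).
case: (x 0) (y 0) => -[] //.
- by move/einj->.
- by move/edisj.
- by move/esym/edisj.
- by move/einj->.
Qed.

Lemma range_glue (T : Type) (e : bool -> cantor_space -> T) :
  range (glue e) = \bigcup_b range (e b).
Proof.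
rewrite eqEsubset; split=> [_ [x _ <-]|_ [b _ [x _ <-]]].
  by exists (x 0) => //; exists (btail x).
by exists (bcons b x).
Qed.

(** A nonempty clopen set is a Cantor set.  By induction on the number [n] of
    bits it depends on: split it according to the first bit.  Either both halves
    are nonempty, and their parametrizations glue, or one half is the whole set
    and inherits the parametrization of that half. *)
Lemma clopen_parametrization n (A : set cantor_space) :
  (forall y z, agree n y z -> A y -> A z) -> A !=set0 ->
  exists e : cantor_space -> cantor_space,
    [/\ continuous e, injective e & range e = A].
Proof.
elim: n A => [|n IH] A An A0.
  exists id; split => //; first by move=> x; exact: cvg_id.
  rewrite eqEsubset; split=> [y _|y _]; last by exists y.
  by have [a Aa] := A0; exact: An Aa.
have IHb b : bcons b @^-1` A !=set0 -> exists e : cantor_space -> cantor_space,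
    [/\ continuous e, injective e & range e = A `&` [set y | y 0 = b]].
  move=> Ab; have [y z yz|e [ec ei eA]] := IH (bcons b @^-1` A) _ Ab.
    by apply: An; exact: agree_bcons.
  exists (bcons b \o e); split.
  - by move=> x; apply: continuous_comp; [exact: ec | exact: bcons_continuous].
  - by move=> x y /bcons_inj/ei.
  - rewrite eqEsubset; split=> [_ [x _ <-]|y [Ay yb]].
      by split => //; have : range e (e x) by [exists x]; rewrite eA.
    have : range e (btail y) by rewrite eA /preimage /= -yb bcons_btail.
    by case=> x _ exy; exists x => //=; rewrite exy -yb bcons_btail.
have [[b Ab]|/forallNP Ab] :=
    pselect (exists b, ~ (bcons b @^-1` A !=set0)).
  have Ay0 y : A y -> y 0 = ~~ b.
    move=> Ay; apply/eqP; rewrite -[~~ b]addbT -[y 0 == _]negbK.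
    apply/negP => yb; apply: Ab; exists (btail y).
    suff <- : y 0 = b by rewrite /preimage /= bcons_btail.
    by move: yb; case: (y 0) b => -[].
  have [|e [ec ei eA]] := IHb (~~ b).
    by have [a Aa] := A0; exists (btail a); rewrite /preimage /= -(Ay0 a)// bcons_btail.
  exists e; split => //; rewrite eA; apply/setIidPl => y; exact: Ay0.
have /choice[e eP] : forall b, exists e : cantor_space -> cantor_space,
    [/\ continuous e, injective e & range e = A `&` [set y | y 0 = b]].
  by move=> b; apply: IHb; exact: contrapT (Ab b).
have eb b x : e b x 0 = b.
  have [_ _ eA] := eP b.
  by have : range (e b) (e b x) by [exists x]; rewrite eA => -[].
exists (glue e); split.
- by apply: glue_continuous => b; have [] := eP b.
- apply: glue_inj => [b|x y exy]; first by have [] := eP b.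
  by have := eb true x; rewrite exy eb.
- rewrite range_glue eqEsubset; split=> [y [b _]|y Ay].
    by have [_ _ ->] := eP b; case.
  by exists (y 0) => //; have [_ _ ->] := eP (y 0).
Qed.

(** The fibres of [phi] over the cylinders of length [m] are parametrized
    simultaneously by these cylinders.  By induction on [m], splitting [A]
    according to the first bit of [phi]; the hitting hypothesis says that no fibre
    is empty, so that the base case applies to each of them. *)
Lemma fibrewise_parametrization n m (A : set cantor_space)
    (phi : cantor_space -> cantor_space) :
  (forall y z, agree n y z -> A y -> A z) ->
  (forall y z, agree n y z -> phi y = phi z) ->
  (forall x, exists2 y, A y & agree m x (phi y)) ->
  exists e : cantor_space -> cantor_space,
    [/\ continuous e, injective e, range e = A &
        forall x, agree m x (phi (e x))].
Proof.
elim: m A phi => [|m IH] A phi An phin hit.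
  have [|e [ec ei eA]] := clopen_parametrization An; last by exists e; split.
  by have [y Ay _] := hit point; exists y.
have /choice[e eP] : forall b, exists e : cantor_space -> cantor_space,
    [/\ continuous e, injective e, range e = A `&` [set y | phi y 0 = b] &
        forall x, agree m x (btail (phi (e x)))].
  move=> b; apply: (IH _ (btail \o phi)) => [y z yz [Ay yb]|y z yz|x].
  - by split; [exact: An Ay | rewrite /= -(phin y)].
  - by rewrite /= (phin y z).
  - have [y Ay bxy] := hit (bcons b x); exists y; last exact: agree_btail bxy.
    by split=> //=; rewrite -bxy.
have eA b x : A (e b x) /\ phi (e b x) 0 = b.
  have [_ _ eA _] := eP b.
  by have : range (e b) (e b x) by [exists x]; rewrite eA.
exists (glue e); split.
- by apply: glue_continuous => b; have [] := eP b.
- apply: glue_inj => [b|x y exy]; first by have [] := eP b.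
  by have [_] := eA true x; rewrite exy (eA false y).2.
- rewrite range_glue eqEsubset; split=> [y [b _]|y Ay].
    by have [_ _ -> _] := eP b; case.
  by exists (phi y 0) => //; have [_ _ ->] := eP (phi y 0).
- move=> x; rewrite -[X in agree _ X _]bcons_btail /glue => -[|i] im /=.
    by rewrite (eA _ _).2.
  by have [_ _ _ /(_ (btail x) i im)] := eP (x 0).
Qed.

Lemma compact_bijection_homeo (S T : topologicalType) (e : S -> T) :
  compact [set: S] -> hausdorff_space T -> continuous e -> injective e ->
  range e = setT -> exists k, inverse_homeomorphisms e k.
Proof.
move=> cS hT ec ei eT.
have /choice[k ek] : forall t, exists s, e s = t.
  by move=> t; have : range e t by [rewrite eT]; case=> s _ <-; exists s.
have ke : cancel e k by move=> s; apply: ei; rewrite ek.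
exists k; split => //.
apply/continuous_closedP => F cF.
have -> : k @^-1` F = e @` F.
  rewrite eqEsubset; split=> [t Fkt|_ [s Fs <-]]; first by exists (k t).
  by rewrite /preimage /= ke.
apply: compact_closed => //; apply: continuous_compact.
  exact: continuous_subspaceT.
exact: subclosed_compact cF cS _.
Qed.

(** A locally constant self-map of [C] that meets every cylinder of length [m]
    agrees with a homeomorphism up to the first [m] bits. *)
Lemma approx_by_homeo m (phi : cantor_space -> cantor_space) :
  (forall y, \forall z \near y, phi z = phi y) ->
  (forall x, exists y, agree m x (phi y)) ->
  exists psi ipsi : cantor_space -> cantor_space,
    inverse_homeomorphisms psi ipsi /\ forall y, agree m (psi y) (phi y).
Proof.
move=> phi_loc hit.
have [|n phin] := @lebesgue_number (fun y z => phi y = phi z).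
  move=> x; exists [set z | phi z = phi x]; first exact: phi_loc.
  by move=> y z /= -> ->.
have [//|//|x|e [ec ei eT eP]] := @fibrewise_parametrization n m setT phi.
  by have [y xy] := hit x; exists y.
have [k [_ kc ek ke]] := compact_bijection_homeo cantor_space_compact
  cantor_space_hausdorff ec ei eT.
exists k, e; split=> [|y]; first by split.
by have := eP (k y); rewrite ke.
Qed.

(** * Towers over a set without short returns *)

(** If all points returned before time [n], then [n!] would be a common period. *)
Lemma aperiodic_no_short_return (T : Type) (g : T -> T) n :
  aperiodic g -> exists y, forall j, (0 < j < n)%N -> iter j g y <> y.
Proof.
move=> g_aper; apply: contrapT => /forallNP short.
apply: (g_aper n`! (fact_gt0 n)); apply: functional_extensionality_dep => y.
have /existsNP[j /not_implyP[/andP[j0 jn] /contrapT gjy]] := short y.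
have /dvdnP[q ->] : (j %| n`!)%N by rewrite dvdn_fact// j0 ltnW.
by rewrite iterM; elim: q => //= q ->.
Qed.

Lemma iter_continuous (T : topologicalType) (g : T -> T) n :
  continuous g -> continuous (iter n g).
Proof.
move=> gc; elim: n => [|n IH] x; first exact: cvg_id.
exact: (@continuous_comp _ _ _ (iter n g) g x (IH x) (gc _)).
Qed.

(** For each [j < n] some bit tells [y] from its [j]-th image, and goes on doing
    so near [y]; a cylinder deep enough to see these bits cannot return. *)
Lemma cylinder_no_short_return (g : cantor_space -> cantor_space) n y :
  continuous g -> (forall j, (0 < j < n)%N -> iter j g y <> y) ->
  exists N, forall j z, (0 < j < n)%N -> agree N y z -> ~ agree N y (iter j g z).
Proof.
move=> gc; elim: n => [|n IH] yret; first by exists 0 => j z; rewrite ltn0 andbF.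
have [j /andP[j0 jn]|N NP] := IH; first by apply: yret; rewrite j0 ltnW.
case: n => [|n] in yret NP {IH} *.
  by exists 0 => j z; rewrite ltnS andbC; case: j.
have /existsNP[i yi] : ~ forall i, iter n.+1 g y i = y i.
  move=> gy; apply: (yret n.+1); first by rewrite !ltnS leqnn.
  exact: functional_extensionality_dep.
have /nbhs_cylinder[M MP] : \forall z \near y, iter n.+1 g z i = iter n.+1 g y i.
  exact: (@iter_continuous cantor_space g n.+1 gc y _ (nbhs_bit (iter n.+1 g y) i)).
exists (maxn N (maxn M i.+1)) => j z /andP[j0]; rewrite ltnS leq_eqVlt.
move=> /predU1P[->|jn] yz yjz.
  apply: yi; rewrite -(MP z); last first.
    by apply: agreeW yz; rewrite leq_max leq_max leqnn orbT.
  by apply/esym/yjz; rewrite !leq_max leqnn !orbT.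
apply: (NP j z); rewrite ?j0 //.
  by apply: agreeW yz; rewrite leq_max leqnn.
by apply: agreeW yjz; rewrite leq_max leqnn.
Qed.

Section Height.
Variables (T : Type) (A : set T) (k : T -> T).

(** The number of backward steps needed to enter [A], truncated at [n]; [k] is
    meant to be the inverse of the dynamics.  The truncated value [n] marks the
    points outside the tower of height [n] over [A]. *)
Fixpoint height n y : nat :=
  if n is m.+1 then if `[< A y >] then 0 else (height m (k y)).+1 else 0.

Lemma height_le n y : (height n y <= n)%N.
Proof. by elim: n y => //= n IH y; case: asboolP => // _; rewrite ltnS. Qed.

Lemma height_truncate n y : height n y = minn n (height n.+1 y).
Proof.
elim: n y => [|n IH] y; first by rewrite min0n.
rewrite [LHS]/=  [height n.+2 y]/= -/(height n.+1 (k y)).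
by case: asboolP => // _; rewrite minnSS -IH.
Qed.

Lemma height_hit n y : (height n y < n)%N -> A (iter (height n y) k y).
Proof.
elim: n y => //= n IH y; case: asboolP => // _.
by rewrite ltnS => /IH; rewrite -iterSr.
Qed.

Variable g : T -> T.
Hypotheses (gK : cancel g k) (kK : cancel k g).

Lemma height_floor n i a : (i < n)%N -> A a ->
  (forall j, (0 < j <= i)%N -> ~ A (iter j g a)) -> height n (iter i g a) = i.
Proof.
elim: i n => [|i IH] [|n] //= lin Aa out; first by case: asboolP.
case: asboolP => [Ag|_].
  by have := out i.+1; rewrite !leqnn => /(_ isT Ag).
rewrite gK IH// => j /andP[j0 ji]; apply: out.
by rewrite j0 ltnW.
Qed.

(** A point on a floor below the top one moves one floor up, since entering [A]
    instead would be a short return; a point on the top floor may also fall back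
    to the base, and a point outside the tower stays outside or enters at the
    base. *)
Lemma height_step n y :
  (forall j a, (0 < j < n)%N -> A a -> ~ A (iter j g a)) ->
  [\/ (height n y < n)%N /\ height n (g y) = (height n y).+1,
      (height n y).+1 = n /\ height n (g y) = 0 |
      height n y = n /\ (height n (g y) = 0 \/ height n (g y) = n)].
Proof.
move=> ret; have hn := height_le n y.
case: n => [|n] in ret hn *; first by constructor 3; split=> //; left.
have hg : height n.+1 (g y) =
    if `[< A (g y) >] then 0 else (minn n (height n.+1 y)).+1.
  by rewrite -height_truncate /= gK.
rewrite hg; case: asboolP => [Agy|_].
  move: hn; rewrite leq_eqVlt => /predU1P[->|hn].
    by constructor 3; split=> //; left.
  constructor 2; split=> //; apply/eqP; rewrite eqn_leq hn leqNgt.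
  apply/negP => hn'; have /ret := height_hit hn.
  move=> /(_ (height n.+1 y).+1 hn'); apply => /=.
  suff -> : iter (height n.+1 y) g (iter (height n.+1 y) k y) = y by [].
  elim: (height n.+1 y) => // i IH.
  by rewrite iterSr [iter i.+1 k y]iterS kK.
move: hn; rewrite leq_eqVlt => /predU1P[->|hn].
  by constructor 3; split=> //; right; congr _.+1; apply/minn_idPl.
by constructor 1; split=> //; congr _.+1; apply/minn_idPr.
Qed.

End Height.

Lemma height_locally_constant (T : topologicalType) (A : set T) (k : T -> T) n :
  (forall y, \forall z \near y, A z <-> A y) -> continuous k ->
  forall y, \forall z \near y, height A k n z = height A k n y.
Proof.
move=> A_loc kc; elim: n => [|n IH] y /=; first by near=> z.
near=> z; congr (if _ then _ else _.+1).
  by apply: asbool_equiv_eq; near: z; exact: A_loc.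
by near: z; exact: kc (IH (k y)).
Unshelve. all: by end_near. Qed.

(** * Chains and the approximating map *)

Local Open Scope ring_scope.

Section Chains.
Variables (R : realType) (X : metricType R) (f : X -> X) (delta : R).

Definition concat (l : nat) (c c' : nat -> X) : nat -> X :=
  fun i => if (i <= l)%N then c i else c' (i - l)%N.

Lemma is_chain_concat x y z l l' c c' :
  is_chain f delta x y l c -> is_chain f delta y z l' c' ->
  is_chain f delta x z (l + l') (concat l c c') /\
  forall i, (i <= l')%N -> concat l c c' (l + i)%N = c' i.
Proof.
move=> [c0 cl cP] [c'0 c'l c'P].
have ccE i : concat l c c' (l + i)%N = c' i.
  rewrite /concat -[X in (_ <= X)%N]addn0 leq_add2l leqn0 addKn.
  by case: eqP => // ->; rewrite addn0 cl c'0.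
split=> //; split; first by rewrite /concat leq0n.
  by rewrite ccE.
move=> i; have [il _|li] := ltnP i l.
  by rewrite /concat ltnW// il; exact: cP.
by rewrite -(subnKC li) ltn_add2l -addnS !ccE; exact: c'P.
Qed.

(** A loop at [p] through finitely many prescribed points, by concatenating
    detours from [p] to each of them and back. *)
Lemma chain_through p (s : seq X) :
  (forall x y, exists l c, is_chain f delta x y l c) ->
  exists l c, is_chain f delta p p l c /\
    forall x, x \in s -> exists2 i, (i <= l)%N & c i = x.
Proof.
move=> f_trans; elim: s => [|x s [l [c [cP cs]]]].
  by exists 0%N, (fun=> p); split; [split | ].
have [l1 [c1 c1P]] := f_trans p x; have [l2 [c2 c2P]] := f_trans x p.
have [c12P c12E] := is_chain_concat c1P c2P.
have [cc cE] := is_chain_concat c12P cP.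
exists (l1 + l2 + l)%N, (concat (l1 + l2) (concat l1 c1 c2) c).
split=> // y; rewrite inE => /predU1P[->|/cs[i il <-]]; last first.
  by exists (l1 + l2 + i)%N; [rewrite leq_add2l | rewrite cE].
exists l1; first by rewrite -addnA leq_addr.
by rewrite /concat leq_addr leqnn; have [] := c1P.
Qed.

End Chains.

Lemma cylinder_list m : exists s : seq cantor_space,
  forall x, exists2 y, y \in s & agree m x y.
Proof.
elim: m => [|m [s sP]]; first by exists [:: point] => x; exists point; rewrite ?inE.
exists (map (bcons true) s ++ map (bcons false) s) => x.
have [y ys xy] := sP (btail x); exists (bcons (x 0%N) y).
  rewrite mem_cat; apply/orP.
  by case: (x 0%N); [left|right]; apply/mapP; exists y.
by rewrite -[X in agree _ X _]bcons_btail; exact: agree_bcons.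
Qed.

Lemma cantor_modulus (R : realType) (X : metricType R) (u : cantor_space -> X)
    (e : R) : continuous u -> 0 < e ->
  exists m, forall y z, agree m y z -> mdist (u y) (u z) < e.
Proof.
move=> uc e0; apply: lebesgue_number => x.
exists [set y | mdist (u x) (u y) < e / 2].
  by apply: (metricType_numDomainType.cvgr_dist_lt (uc x)); rewrite divr_gt0.
move=> y z /= xy xz; rewrite (le_lt_trans (metric_triangle (u y) (u x) _))//.
by rewrite [e]splitr ltrD// metric_sym.
Qed.

(** The theorem for a homeomorphism [g] of [C], at precision [e]: [h] and [ih]
    identify [X] with [C], and [phi] reads the chain [c] along the tower. *)
Lemma cantor_approx (R : realType) (X : metricType R) (f : X -> X) (p : X)
    (h : X -> cantor_space) (ih : cantor_space -> X)
    (g k : cantor_space -> cantor_space) (e : R) :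
  continuous f -> chain_mixing f -> f p = p ->
  inverse_homeomorphisms h ih -> inverse_homeomorphisms g k -> aperiodic g ->
  0 < e ->
  exists psi ipsi : cantor_space -> cantor_space,
    inverse_homeomorphisms psi ipsi /\
    forall w, mdist (ih (psi (g w))) (f (ih (psi w))) < e.
Proof.
move=> fc f_mix fp [_ ihc hK ihK] [gc kc gK kK] g_aper e0.
have e3 : 0 < e / 3 by rewrite divr_gt0.
have [m1 m1P] := cantor_modulus ihc e3.
have fihc : continuous (f \o ih).
  by move=> x; apply: continuous_comp; [exact: ihc | exact: fc].
have [m2 m2P] := cantor_modulus fihc e3.
pose m := maxn m1 m2.
have [s sP] := cylinder_list m.
have [|n [c [[c0 cn cP] cs]]] := @chain_through _ _ f (e / 3) p (map ih s).
  move=> x y; have [N [_ NP]] := f_mix _ e3 x y.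
  by have [c cP] := NP N (leqnn N); exists N, c.
have [y yret] := aperiodic_no_short_return n g_aper.
have [N NP] := cylinder_no_short_return gc yret.
pose A := agree N y.
have A_loc x : \forall z \near x, A z <-> A x.
  near=> z; have xz : agree N x z by near: z; exact: nbhs_agree.
  split=> [yz|yx]; last exact: agree_trans xz.
  exact: agree_trans yz (agree_sym xz).
have ret j a : (0 < j < n)%N -> A a -> ~ A (iter j g a) by exact: NP.
pose phi w := h (c (height A k n w)).
have phi_loc x : \forall z \near x, phi z = phi x.
  near=> z; congr (h (c _)); near: z.
  exact: (@height_locally_constant cantor_space A k n A_loc kc x).
have hit x : exists w, agree m x (phi w).
  have [z zs xz] := sP x.
  have [i lin ciz] := cs (ih z) (map_f ih zs).
  have Ay : A y by [].
  (* The last point of the chain is also the first one, so its index can be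
     taken to be 0, which is a floor of the tower; for [n = 0] the height is 0
     everywhere. *)
  have {lin ciz}[i' lin ciz] : exists2 i, (i < n)%N || (i == 0)%N & c i = ih z.
    move: lin; rewrite leq_eqVlt => /predU1P[ni|lin]; last first.
      by exists i; rewrite ?lin.
    by exists 0%N; rewrite ?orbT // -ciz ni cn c0.
  exists (iter i' g y); rewrite /phi.
  suff -> : height A k n (iter i' g y) = i' by rewrite ciz ihK.
  case/orP: lin => [lin|/eqP->] /=.
    apply: height_floor => // j /andP[j0 ji].
    by apply: ret => //; rewrite j0 (leq_ltn_trans ji).
  by case: (n) => //= n'; case: asboolP.
have [psi [ipsi [psiP psi_phi]]] := approx_by_homeo phi_loc hit.
exists psi, ipsi; split=> // w.
have step : mdist (f (ih (phi w))) (ih (phi (g w))) < e / 3.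
  rewrite /phi !hK.
  have fpp : mdist (f p) p < e / 3 by rewrite fp mdistxx.
  case: (@height_step _ A k g gK kK n w ret) => [[hn ->]|[hn ->]|[-> [->|->]]].
  - exact: cP.
  - have : (height A k n w < n)%N by rewrite -[ltnRHS]hn.
    by move=> /cP; rewrite hn cn c0.
  - by rewrite c0 cn.
  - by rewrite cn.
(* Replace [psi] by [phi] at both ends, at a cost below [e / 3] each time. *)
have eE : e = e / 3 + (e / 3 + e / 3) by lra.
rewrite (le_lt_trans (metric_triangle _ (ih (phi (g w))) _))// [ltRHS]eE ltrD//.
  by apply: m1P; apply: agreeW (psi_phi _); rewrite leq_maxl.
rewrite (le_lt_trans (metric_triangle _ (f (ih (phi w))) _))// ltrD//.
  by rewrite metric_sym.
by apply: m2P; apply: agreeW (agree_sym (psi_phi _)); rewrite leq_maxr.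
Unshelve. all: by end_near. Qed.

(** * Transport to the given spaces *)

Lemma inverse_homeomorphisms_comp (S T U : topologicalType)
    (h : S -> T) (k : T -> S) (h' : T -> U) (k' : U -> T) :
  inverse_homeomorphisms h k -> inverse_homeomorphisms h' k' ->
  inverse_homeomorphisms (h' \o h) (k \o k').
Proof.
move=> [hc kc hK kK] [h'c k'c h'K k'K]; split.
- by move=> x; apply: continuous_comp; [exact: hc | exact: h'c].
- by move=> x; apply: continuous_comp; [exact: k'c | exact: kc].
- exact: can_comp.
- exact: can_comp.
Qed.

Lemma inverse_homeomorphisms_sym (S T : topologicalType)
    (h : S -> T) (k : T -> S) :
  inverse_homeomorphisms h k -> inverse_homeomorphisms k h.
Proof. by case. Qed.

Lemma aperiodic_conj (S T : Type) (h : S -> T) (k : T -> S) (g : S -> S) :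
  cancel h k -> cancel k h -> aperiodic g -> aperiodic (h \o g \o k).
Proof.
move=> hK kK g_aper n n0 per; apply: (g_aper n n0).
apply: functional_extensionality_dep => x.
have iterE m : iter m (h \o g \o k) (h x) = h (iter m g x).
  by elim: m => //= m ->; rewrite hK.
by apply: (can_inj hK); rewrite -iterE per.
Qed.

Lemma sup_dist_itv (R : realType) (X : metricType R) (f f' : X -> X) (e : R) :
  inhabited X -> (forall x, mdist (f x) (f' x) <= e) ->
  0 <= sup_dist f f' <= e.
Proof.
move=> [x0] ffe.
have ub : ubound [set mdist (f x) (f' x) | x in [set: X]] e.
  by move=> _ [x _ <-].
apply/andP; split; last by apply: ge_sup => //; exists (mdist (f x0) (f' x0)), x0.
apply: le_trans (mdist_ge0 (f x0) (f' x0)) _.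
by apply: ub_le_sup; [exists e | exists x0].
Qed.

Theorem corollary1p2 (R : realType) (X Y : metricType R)
    (X_compact : compact [set: X]) (Y_compact : compact [set: Y])
    (X_cantor : homeomorphic X cantor_space)
    (Y_cantor : homeomorphic Y cantor_space)
    (f : X -> X) (f_cont : continuous f)
    (f_surj : set_surj [set: X] [set: X] f)
    (f_mixing : chain_mixing f)
    (g : Y -> Y) (g_homeo : is_homeomorphism g) (g_aperiodic : aperiodic g)
    (f_fixed : exists p : X, f p = p) :
  conjugates_approximate g f.
Proof.
have [[hX [kX hkX]] [hY [kY hkY]]] := (X_cantor, Y_cantor).
have [[k gk] [p fp]] := (g_homeo, f_fixed).
have approx (n : nat) : exists psiphi : (Y -> X) * (X -> Y),
    inverse_homeomorphisms psiphi.1 psiphi.2 /\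
    0 <= sup_dist (psiphi.1 \o g \o psiphi.2) f <= harmonic n.
  have [_ _ hYK kYK] := hkY.
  have gk' : inverse_homeomorphisms (hY \o g \o kY) (hY \o k \o kY).
    exact: (inverse_homeomorphisms_comp (inverse_homeomorphisms_sym hkY)
             (inverse_homeomorphisms_comp gk hkY)).
  have [psi [phi [psiphi psiP]]] := cantor_approx f_cont f_mixing fp hkX gk'
    (aperiodic_conj hYK kYK g_aperiodic) (harmonic_gt0 n).
  have psiphi' := inverse_homeomorphisms_comp
    (inverse_homeomorphisms_comp hkY psiphi) (inverse_homeomorphisms_sym hkX).
  exists (kX \o (psi \o hY), (kY \o phi) \o hX); split=> //=.
  apply: sup_dist_itv => [|x]; first exact: inhabits p.
  have [_ _ _ /(_ x) /= xE] := psiphi'.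
  rewrite -[X in f X]xE /=.
  have := psiP (hY (kY (phi (hX x)))); rewrite /= hYK => /ltW.
  by [].
have [s sP] := choice approx.
exists (fun n => (s n).1), (fun n => (s n).2).
split=> [n|]; first by have [] := sP n.
apply: (@squeeze_cvgr _ _ _ R (fun=> 0) harmonic _ _ 0).
- by near=> n; have [] := sP n.
- exact: cvg_cst.
- exact: cvg_harmonic.
Unshelve. all: by end_near. Qed.
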